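(* Let $F_k = \langle x_1, \dots, x_k \rangle$ be the free group of rank $k$ on $x_1,\dots,x_k$, let $\ell$ be a prime number, let $\gamma_\ell(F_k)$ be the $\ell$-th term of the lower central series of $F_k$, and let $F_k^\ell = \langle g^\ell \mid g \in F_k\rangle$ be the subgroup generated by the $\ell$-th powers. Then every nontrivial $w \in F_k^\ell\,\gamma_\ell(F_k)$ satisfies $\mathrm{length}(w) \ge \ell$, and equality is attained if and only if $w = x_i^{\ell}$ or $w = x_i^{-\ell}$ for some index $i \in \{1,\dots,k\}$.
   Context: The lower central series of a group $F$ is indexed by $\gamma_1(F) = F$ and $\gamma_{n+1}(F) = [\gamma_n(F), F]$, so that $\gamma_2(F) = [F,F]$. For $w \in F_k$, $\mathrm{length}(w)$ is the length of the reduced word in $x_1^{\pm 1},\dots,x_k^{\pm 1}$ representing $w$, i.e. the distance from $1$ to $w$ in the Cayley graph of $F_k$ with respect to $\{x_1,\dots,x_k\}$. *)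

(* Defs.v *)
From HB Require Import structures.
From mathcomp Require Import all_boot.

Set Implicit Arguments.
Unset Strict Implicit.
Unset Printing Implicit Defensive.

Local Open Scope group_scope.

(* Subsets of a group are Prop-valued predicates, since membership in the
   subgroups below is not decidable in a general [groupType]. *)
Section Subgroups.
Variable G : groupType.
Implicit Types A B : G -> Prop.

Inductive gen_subgroup A : G -> Prop :=
| gen_subgroup_in x : A x -> gen_subgroup A x
| gen_subgroup1 : gen_subgroup A 1
| gen_subgroupM x y : gen_subgroup A x -> gen_subgroup A y ->
    gen_subgroup A (x * y)
| gen_subgroupV x : gen_subgroup A x -> gen_subgroup A x^-1.

Definition comm_subgroup A B : G -> Prop :=
  gen_subgroup (fun z => exists x y, [/\ A x, B y & z = [~ x, y]]).

Definition set_prod A B : G -> Prop :=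
  fun z => exists x y, [/\ A x, B y & z = x * y].

End Subgroups.

(* Indexing starts at 1, as for MathComp's 'L_n(G): lower_central G 1 is the
   whole group and lower_central G n.+1 = [lower_central G n, G] for n > 0.
   (The junk value at n = 0 is the whole group.) *)
Definition lower_central (G : groupType) (n : nat) : G -> Prop :=
  iter n.-1 (fun H => comm_subgroup H (fun=> True)) (fun=> True).

Definition power_subgroup (G : groupType) (n : nat) : G -> Prop :=
  gen_subgroup (fun z => exists g : G, z = g ^+ n).

Arguments lower_central : clear implicits.
Arguments power_subgroup : clear implicits.

(* The free group of rank k, as the set of reduced words.  The letter
   (i, false) stands for x_i and (i, true) for its inverse; the indices
   1, ..., k become 0, ..., k - 1. *)
Notation letter k := ('I_k * bool)%type.

Definition linv k (a : letter k) : letter k := (a.1, ~~ a.2).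

Definition reduced k (s : seq (letter k)) : bool :=
  sorted (fun a b => b != linv a) s.

Record freegroup (k : nat) : Type :=
  FreeGroup { fgword :> seq (letter k); fgwordP : reduced fgword }.

HB.instance Definition _ k := [isSub for @fgword k].
HB.instance Definition _ k := [Choice of freegroup k by <:].

Definition push k (a : letter k) (s : seq (letter k)) : seq (letter k) :=
  if s is b :: s' then if b == linv a then s' else a :: s else [:: a].

(* For reduced t, the reduced form of the concatenation s ++ t. *)
Definition wmul k (s t : seq (letter k)) : seq (letter k) :=
  foldr (@push k) t s.

Definition winv k (s : seq (letter k)) : seq (letter k) :=
  rev (map (@linv k) s).

Section FreeGroupTheory.
Variable k : nat.
Implicit Types (a b : letter k) (s t u : seq (letter k)).

Lemma linvK : involutive (@linv k).
Proof. by case=> i b; rewrite /linv /= negbK. Qed.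

Lemma linv_neq a : (linv a == a) = false.
Proof. by case: a => i []; rewrite /linv xpair_eqE andbF. Qed.

Lemma linv_eqC a b : (b == linv a) = (a == linv b).
Proof. by rewrite -(inj_eq (inv_inj linvK)) linvK eq_sym. Qed.

Lemma reduced_behead a s : reduced (a :: s) -> reduced s.
Proof. by case: s => //= b s /andP[]. Qed.

Lemma push_reduced a s : reduced s -> reduced (push a s).
Proof.
case: s => //= b s rs; case: ifP => [_|/negbT h]; first exact: reduced_behead rs.
by rewrite /reduced /= h.
Qed.

Lemma push_cons a s : reduced (a :: s) -> push a s = a :: s.
Proof. by case: s => //= b s /andP[/negbTE ->]. Qed.

Lemma pushK a s : reduced s -> push a (push (linv a) s) = s.
Proof.
case: s => [|b s] rs /=; first by rewrite eqxx.
rewrite linvK; case: eqP => [eba|_] /=; last by rewrite eqxx.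
by rewrite -eba push_cons.
Qed.

Lemma wmul_reduced s t : reduced t -> reduced (wmul s t).
Proof. by move=> rt; elim: s => //= a s; apply: push_reduced. Qed.

Lemma wmul0 s : reduced s -> wmul s [::] = s.
Proof.
elim: s => //= a s IHs rs.
by rewrite IHs ?push_cons //; apply: reduced_behead rs.
Qed.

Lemma wmul_push a s t : reduced t -> wmul (push a s) t = push a (wmul s t).
Proof.
case: s => //= b s rt; case: eqP => [->|//].
by rewrite pushK //; apply: wmul_reduced.
Qed.

Lemma wmulA s t u : reduced u -> wmul s (wmul t u) = wmul (wmul s t) u.
Proof. by move=> ru; elim: s => //= a s ->; rewrite wmul_push. Qed.

Lemma winv_reduced s : reduced s -> reduced (winv s).
Proof.
move=> rs; rewrite /reduced /winv rev_sorted sorted_map.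
by apply: sub_sorted rs => a b /= ba; rewrite linvK eq_sym.
Qed.

Lemma wmulVs s : wmul (winv s) s = [::].
Proof.
elim: s => // a s IHs.
by rewrite /winv /= rev_cons /wmul foldr_rcons /= linvK eqxx.
Qed.

Lemma winvK : involutive (@winv k).
Proof. by move=> s; rewrite /winv map_rev revK (mapK linvK). Qed.

Lemma wmulsV s : wmul s (winv s) = [::].
Proof. by have := wmulVs (winv s); rewrite winvK. Qed.

Definition fgone : freegroup k := @FreeGroup k [::] isT.
Definition fgmul (x y : freegroup k) : freegroup k :=
  FreeGroup (wmul_reduced x (fgwordP y)).
Definition fginv (x : freegroup k) : freegroup k :=
  FreeGroup (winv_reduced (fgwordP x)).

Lemma fgmulA : associative fgmul.
Proof. by move=> x y z; apply/val_inj/wmulA/fgwordP. Qed.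
Lemma fgmul1g : left_id fgone fgmul.
Proof. by move=> x; apply/val_inj. Qed.
Lemma fgmulg1 : right_id fgone fgmul.
Proof. by move=> x; apply/val_inj/wmul0/fgwordP. Qed.
Lemma fgmulVg : left_inverse fgone fginv fgmul.
Proof. by move=> x; apply/val_inj/wmulVs. Qed.
Lemma fgmulgV : right_inverse fgone fginv fgmul.
Proof. by move=> x; apply/val_inj/wmulsV. Qed.

End FreeGroupTheory.

HB.instance Definition _ k := isGroup.Build (freegroup k)
  (@fgmulA k) (@fgmul1g k) (@fgmulg1 k) (@fgmulVg k) (@fgmulgV k).

Definition fgX k (i : 'I_k) : freegroup k := @FreeGroup k [:: (i, false)] isT.

(* Elements are reduced words, so this is the distance to 1 in the Cayley graph
   with respect to the fgX i. *)
Definition fglength k (w : freegroup k) : nat := size (fgword w).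

Definition fglift k (G : groupType) (f : 'I_k -> G) (w : freegroup k) : G :=
  \prod_(a <- fgword w) (if a.2 then (f a.1)^-1 else f a.1).

Lemma fgliftM k (G : groupType) (f : 'I_k -> G) :
  {morph fglift f : x y / x * y}.
Proof.
move=> x y; rewrite /fglift /=.
elim: (fgword x) => [|a s IHs] /=; first by rewrite big_nil mul1g.
rewrite big_cons -mulgA -IHs.
case: (wmul s (fgword y)) => [|b t] /=; first by rewrite !big_cons.
case: eqP => [->|_]; rewrite !big_cons //=.
by case: a.2 => /=; rewrite ?mulKg ?mulVKg.
Qed.

Lemma fgliftX k (G : groupType) (f : 'I_k -> G) i : fglift f (fgX i) = f i.
Proof. by rewrite /fglift /= big_seq1. Qed.

Lemma fglift_unique k (G : groupType) (h1 h2 : freegroup k -> G) :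
    {morph h1 : x y / x * y} -> {morph h2 : x y / x * y} ->
  (forall i, h1 (fgX i) = h2 (fgX i)) -> h1 =1 h2.
Proof.
move=> m1 m2 e.
have h11 (h : freegroup k -> G) : {morph h : x y / x * y} -> h 1 = 1.
  by move=> m; apply: (mulIg (h 1)); rewrite -m !mul1g.
have hV (h : freegroup k -> G) x : {morph h : x y / x * y} -> h x^-1 = (h x)^-1.
  by move=> m; apply: (mulIg (h x)); rewrite -m !mulVg h11.
case=> s; elim: s => [|[i b] s IHs] rs.
  have -> : FreeGroup rs = 1 by apply/val_inj.
  by rewrite (h11 _ m1) (h11 _ m2).
have -> : FreeGroup rs =
    (if b then (fgX i)^-1 else fgX i) * FreeGroup (reduced_behead rs).
  by apply/val_inj; case: b rs => rs /=; rewrite push_cons.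
rewrite m1 m2 IHs; congr (_ * _).
by case: b {rs}; rewrite ?(hV _ _ m1) ?(hV _ _ m2) e.
Qed.

(* Main.v *)
Require Import Defs.
From mathcomp Require Import all_boot all_algebra.
From mathcomp Require Import zify.
Set Implicit Arguments.
Unset Strict Implicit.
Unset Printing Implicit Defensive.
Import GRing.Theory.

(** Words are detected by unitriangular matrices of size at most [l] over the
    field with [l] elements.  Such a matrix is [1 + N] with [N ^+ l = 0], so its
    [l]-th power is [1 + N ^+ l = 1]; and the group they form has nilpotency
    class less than [l].  Any representation by these matrices therefore kills
    the product of the [l]-th power subgroup and the [l]-th term of the lower
    central series ([unitri_rep_kills]).

    Let [w] be a nontrivial reduced word of length at most [l], and write it as a
    product of syllables [x_i1 ^ e1 ... x_im ^ em] in which consecutive indices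
    differ.  Unless [w] is a single syllable of length [l], every [ej] satisfies
    [0 < |ej| < l], so is invertible modulo [l].  Suppose first that [m < l].
    Send [x_i] to [1 + N_i], where [N_i] has a 1 at each entry [(j - 1, j)] with
    [ij = i], for [1 <= j <= m].  As consecutive indices differ, [N_i] squares to
    zero and [x_i ^ e] goes to [1 + e N_i].  The corner entry [(0, m)] of the
    image of [w] sums over the ways of climbing from 0 to [m] with [m] factors,
    each of which climbs at most one step; hence it is [e1 ... em], which is
    nonzero.  This is the coefficient of [X_i1 ... X_im] in the Magnus expansion.

    If [m = l], these matrices have size [l + 1], which is one too many.  Use
    instead the path of the first [l - 1] syllables.  The last syllable cannot
    contribute to the corner entry, because climbing the last step requires its
    index to be [i(l - 1)]; so the corner entry is [e1 ... e(l - 1)], again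
    nonzero ([path_rep_coef]).

    Hence a word of length at most [l] in the subgroup is the [l]-th power of a
    letter, which yields both the bound and the case of equality. *)

(** * Unitriangular representations *)

Lemma gen_subgroup_min (G : groupType) (A P : G -> Prop) :
    P 1%g -> (forall x y, P x -> P y -> P (x * y)%g) ->
    (forall x, P x -> P x^-1%g) -> (forall x, A x -> P x) ->
  forall x, gen_subgroup A x -> P x.
Proof. by move=> P1 PM PV sAP x; elim=> {x}; auto. Qed.

Section Band.
Local Open Scope ring_scope.
Variables (R : nzRingType) (n : nat).
Implicit Types A B : 'M[R]_n.+1.

(** The ideals [band d] filter the upper triangular matrices [band 0]: degrees
    add up under products, and everything of degree [n.+1] vanishes. *)
Definition band (d : nat) A : Prop :=
  forall i j : 'I_n.+1, (j < i + d)%N -> A i j = 0.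

Lemma bandD d A B : band d A -> band d B -> band d (A + B).
Proof. by move=> bA bB i j lt_ji; rewrite mxE bA ?bB ?addr0. Qed.

Lemma bandN d A : band d A -> band d (- A).
Proof. by move=> bA i j lt_ji; rewrite mxE bA ?oppr0. Qed.

Lemma bandW d e A : (e <= d)%N -> band d A -> band e A.
Proof.
by move=> le_ed bA i j lt_ji; apply: bA; apply: leq_trans lt_ji _; rewrite leq_add2l.
Qed.

Lemma band0_1 : band 0 1.
Proof. by move=> i j; rewrite addn0 !mxE -val_eqE /=; case: ltngtP. Qed.

Lemma bandM d e A B : band d A -> band e B -> band (d + e) (A * B).
Proof.
move=> bA bB i j lt_ji; rewrite mxE big1 // => k _.
have [lt_ki | le_ik] := ltnP k (i + d); first by rewrite bA ?mul0r.
rewrite [B k j]bB ?mulr0 //; apply: leq_trans lt_ji _.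
by rewrite addnA leq_add2r.
Qed.

Lemma bandX d A m : band d A -> band (m * d) (A ^+ m).
Proof.
move=> bA; elim: m => [|m IHm]; first exact: band0_1.
by rewrite exprS mulSn; apply: bandM.
Qed.

Lemma band_eq0 d A : (n < d)%N -> band d A -> A = 0.
Proof.
move=> lt_nd bA; apply/matrixP=> i j; rewrite mxE bA //.
by rewrite ltn_addl // (leq_trans (ltn_ord j)).
Qed.

End Band.

Section Unitriangular.
Local Open Scope ring_scope.
Variables (G : groupType) (R : fieldType) (n : nat) (rho : G -> 'M[R]_n.+1).
Hypotheses (rho1 : rho 1%g = 1) (rhoM : {morph rho : x y / (x * y)%g >-> x * y}).
Hypothesis rho_unitri : forall g, band 1 (rho g - 1).

(** The analogue, for the filtration by bands, of a dimension subgroup. *)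
Definition dimsub (d : nat) (g : G) : Prop := band d (rho g - 1).

Lemma rho_band0 g : band 0 (rho g).
Proof.
by rewrite -[rho g](subrK 1); apply/bandD/band0_1/bandW/rho_unitri.
Qed.

Lemma dimsub_gen d (A : G -> Prop) :
  (forall x, A x -> dimsub d x) -> forall x, gen_subgroup A x -> dimsub d x.
Proof.
apply: gen_subgroup_min => [|x y dx dy|x dx]; rewrite /dimsub.
- by rewrite rho1 subrr => i j _; rewrite mxE.
- have -> : rho (x * y)%g - 1 = (rho x - 1) * rho y + (rho y - 1).
    by rewrite rhoM mulrBl mul1r addrA subrK.
  by apply: bandD => //; rewrite -[d]addn0; apply: bandM => //; apply: rho_band0.
have -> : rho x^-1%g - 1 = - (rho x^-1%g * (rho x - 1)).
  by rewrite mulrBr mulr1 -rhoM mulVg rho1 opprB.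
by apply/bandN; rewrite -[d]add0n; apply: bandM => //; apply: rho_band0.
Qed.

(** Commutators add degrees: with [X = rho x] and [Y = rho y], the matrix
    [rho [~ x, y] - 1] is [X^-1 Y^-1] times the ring commutator of [X - 1] and
    [Y - 1]. *)
Lemma dimsub_lower_central d g :
  (0 < d)%N -> lower_central G d g -> dimsub d g.
Proof.
case: d => // d _; elim: d g => [|d IHd] g; first by move=> _; apply: rho_unitri.
rewrite /lower_central /=; apply: dimsub_gen => {}g [x [y [/IHd dx _ ->]]].
have dy := rho_unitri y.
rewrite /dimsub.
have -> : rho [~ x, y]%g - 1 =
    rho x^-1%g * rho y^-1%g *
      ((rho x - 1) * (rho y - 1) - (rho y - 1) * (rho x - 1)).
  have -> : (rho x - 1) * (rho y - 1) - (rho y - 1) * (rho x - 1)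
          = rho (x * y)%g - rho (y * x)%g.
    have mulB1 A B : (A - 1) * (B - 1) = A * B - (A + B - 1) :> 'M[R]_n.+1.
      by rewrite mulrBl mulrBr mul1r mulr1 -addrA -opprD addrA.
    rewrite !mulB1 (addrC (rho y)); move: (rho x + _ - 1) => s.
    by rewrite opprB addrA subrK -!rhoM.
  rewrite mulrBr -!rhoM -invgM mulVg rho1; congr (rho _ - 1).
  by rewrite /commg /conjg !mulgA invgM.
(* The inverses have degree 0; the two products have degree [d.+1 + 1]. *)
rewrite -[d.+2]add0n; apply: bandM.
  exact/(@bandM _ _ 0 0)/rho_band0/rho_band0.
apply: bandD; first by rewrite -addn1; apply: bandM.
by apply: bandN; rewrite -add1n; apply: bandM.
Qed.

(** In characteristic [p] the Frobenius identity gives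
    [rho x ^+ p - 1 = (rho x - 1) ^+ p]. *)
Lemma dimsub_power p g : p \in [pchar R] -> power_subgroup G p g -> dimsub p g.
Proof.
move=> pR; apply: dimsub_gen => {}g [x ->].
have pM : p \in [pchar 'M[R]_n.+1] by rewrite pchar_lalg.
have rhoX m : rho (x ^+ m)%g = rho x ^+ m.
  by elim: m => // m IHm; rewrite expgS exprS rhoM IHm.
rewrite /dimsub rhoX.
have -> : rho x ^+ p - 1 = (rho x - 1) ^+ p.
  rewrite -!(pFrobenius_autE pM) pFrobenius_autB_comm ?pFrobenius_aut1 //.
  exact: commr1.
by rewrite -[p in band p]muln1; apply/bandX/rho_unitri.
Qed.

(** Both subgroups lie in [dimsub p], and [band p] is trivial on matrices of size
    [n.+1 <= p]. *)
Lemma unitri_rep_kills p g : p \in [pchar R] -> (n < p)%N ->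
  set_prod (power_subgroup G p) (lower_central G p) g -> rho g = 1.
Proof.
move=> pR lt_np [x [y [/(dimsub_power pR) dx dy ->]]].
have {}dy := dimsub_lower_central (leq_ltn_trans (leq0n n) lt_np) dy.
have triv z : dimsub p z -> rho z = 1.
  by move=> dz; apply/eqP; rewrite -subr_eq0; apply/eqP/(band_eq0 lt_np dz).
by rewrite rhoM !triv ?mulr1.
Qed.

End Unitriangular.

(** * Words and syllables *)

Section WordProduct.
Local Open Scope ring_scope.
Variables (k : nat) (R : nzRingType) (f : letter k -> R).
Hypothesis fV : forall a, f a * f (linv a) = 1.

(** Free reduction only deletes pairs of mutually inverse letters, so a map on
    letters that respects inverses is multiplicative on reduced words. *)
Lemma prod_wmul s t :
  \prod_(a <- wmul s t) f a = (\prod_(a <- s) f a) * \prod_(a <- t) f a.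
Proof.
elim: s => [|a s IHs] /=; first by rewrite big_nil mul1r.
rewrite big_cons -mulrA -IHs.
case: (wmul s t) => [|b u] /=; first by rewrite !big_cons.
by case: eqP => [->|_]; rewrite !big_cons // mulrA fV mul1r.
Qed.

End WordProduct.

(** The pair [(a, n)] stands for [a ^+ n.+1], so that a syllable is never empty. *)
Notation syllable k := (letter k * nat)%type.

Definition sylidx k (s : syllable k) : 'I_k := s.1.1.

Definition expand k (q : seq (syllable k)) : seq (letter k) :=
  flatten [seq nseq s.2.+1 s.1 | s <- q].

Definition alternating (T : eqType) : seq T -> bool :=
  sorted (fun x y => x != y).

Lemma alternating_onth (T : eqType) (p : seq T) r x :
  alternating p -> onth p r = Some x -> onth p r.+1 != Some x.
Proof.
elim: p r => [|y p IHp] [|r] //= alt_p.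
  by case=> <-; case: p alt_p {IHp} => //= z p /andP[+ _]; apply: contraNneq => -[->].
by apply: IHp; apply: path_sorted alt_p.
Qed.

Lemma syllables k (s : seq (letter k)) : reduced s ->
  exists2 q, s = expand q & alternating (map (@sylidx k) q).
Proof.
elim: s => [|a s IHs] rs; first by exists [::].
have [[|[b n] q] def_s altq] := IHs (reduced_behead rs).
  by exists [:: (a, 0)]; rewrite // def_s.
have [eq_ba | ne_ba] := eqVneq b a.
  by exists ((a, n.+1) :: q); [rewrite def_s eq_ba | rewrite -eq_ba].
exists ((a, 0) :: (b, n) :: q); first by rewrite def_s.
suff ne_ab : a.1 != b.1 by apply/andP.
move: rs ne_ba; rewrite def_s /reduced /= => /andP[+ _].
case: a b {altq def_s} => i x [j y]; rewrite /linv /= !xpair_eqE eq_sym.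
by case: eqP => //= _; case: x y => [] [].
Qed.

Lemma expand_cat k (q1 q2 : seq (syllable k)) :
  expand (q1 ++ q2) = expand q1 ++ expand q2.
Proof. by rewrite /expand map_cat flatten_cat. Qed.

Lemma size_expand k (q : seq (syllable k)) : size q <= size (expand q).
Proof.
elim: q => //= s q IHq.
by rewrite ltnS size_cat (leq_trans IHq) ?leq_addl.
Qed.

(** A syllable of length [l] leaves no room for any other. *)
Lemma short_expand k l (q : seq (syllable k)) : size (expand q) <= l ->
  (exists a, expand q = nseq l a) \/ {in q, forall s, s.2.+1 < l}.
Proof.
move=> le_l; have [small | /allPn[s s_q]] := boolP (all (fun s => s.2.+1 < l) q).
  by right; apply/allP.
rewrite -leqNgt => le_ls; left; exists s.1.
case/splitPr: s_q le_l => q1 q2; rewrite -cat1s !expand_cat !size_cat.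
rewrite [expand [:: s]]cats0 size_nseq => le_l.
have /nilP -> : nilp (expand q1) by rewrite /nilp; lia.
have /nilP -> : nilp (expand q2) by rewrite /nilp; lia.
by rewrite cats0; congr nseq; lia.
Qed.

(** * The representation attached to a path of indices *)

Section PathRepresentation.
Local Open Scope ring_scope.
Variables (k : nat) (F : fieldType) (p : seq 'I_k).
Hypothesis alt_p : alternating p.
Local Notation M := 'M[F]_((size p).+1).
Implicit Types (A : M) (a : letter k) (q : seq (syllable k)) (w : freegroup k).

(** The edges of the path [0 -> 1 -> ... -> size p] that are labelled by [i]. *)
Definition step (i : 'I_k) : M :=
  \matrix_(r, c) ((c == r.+1 :> nat) && (onth p r == Some i))%:R.

Definition letter_mx a : M := 1 + (-1) ^+ a.2 *: step a.1.

Definition path_rep w : M := \prod_(a <- fgword w) letter_mx a.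

Lemma mul_step A i r (c d : 'I_(size p).+1) : d = c.+1 :> nat ->
  (A * step i) r d = A r c * (onth p c == Some i)%:R.
Proof.
move=> def_d; rewrite mxE (bigD1 c) //= mxE def_d eqxx big1 ?addr0 // => e ne_ec.
by rewrite mxE def_d eqSS val_eqE [c == e]eq_sym (negPf ne_ec) mulr0.
Qed.

Lemma mul_step_neq A i r (d : 'I_(size p).+1) :
  (forall c, onth p c = Some i -> d != c.+1 :> nat) -> (A * step i) r d = 0.
Proof.
move=> no_c; rewrite mxE big1 // => c _; rewrite mxE.
case: (onth p c =P Some i) => [/no_c/negPf->|_]; last by rewrite andbF mulr0.
by rewrite mulr0.
Qed.

(** Consecutive edges of an alternating path carry different labels. *)
Lemma step_sqr i : step i * step i = 0.
Proof.
apply/matrixP=> r d; rewrite [RHS]mxE.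
have [d0|d_gt0] := posnP d; first by rewrite mul_step_neq // d0.
have lt_d : (d.-1 < (size p).+1)%N by rewrite (leq_ltn_trans (leq_pred d)).
rewrite (@mul_step _ _ _ (Ordinal lt_d)) /= ?prednK // mxE.
case: andP => [[/eqP def_d /eqP pr]|_]; last by rewrite mul0r.
by rewrite [d.-1]def_d (negPf (alternating_onth alt_p pr)) mulr0.
Qed.

Lemma step_comb i x y :
  (1 + x *: step i) * (1 + y *: step i) = 1 + (x + y) *: step i.
Proof.
rewrite mulrDr mulr1 mulrDl mul1r -scalerAl -scalerAr step_sqr !scaler0 addr0.
by rewrite -addrA -scalerDl.
Qed.

Lemma letter_mxV a : letter_mx a * letter_mx (linv a) = 1.
Proof. by rewrite step_comb /= signrN subrr scale0r addr0. Qed.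

Lemma path_rep1 : path_rep 1%g = 1.
Proof. exact: big_nil. Qed.

Lemma path_repM : {morph path_rep : x y / (x * y)%g >-> x * y}.
Proof. by move=> x y; apply: prod_wmul letter_mxV _ _. Qed.

Lemma path_rep_unitri w : band 1 (path_rep w - 1).
Proof.
rewrite /path_rep; elim: (fgword w) => [|a s IHs].
  by rewrite big_nil subrr => i j _; rewrite mxE.
rewrite big_cons; set P := \prod_(b <- s) _ in IHs *.
have bP : band 0 P by rewrite -[P](subrK 1); apply/bandD/band0_1/bandW/IHs.
rewrite mulrDl mul1r addrAC; apply: bandD => //.
rewrite -[1%N]addn0; apply: bandM => // i j; rewrite addn1 ltnS => le_ji.
by rewrite !mxE ltn_eqF ?ltnS // mulr0.
Qed.

(** The exponent of the syllable, as a scalar: its sign lies in the letter. *)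
Definition syl_exponent (s : syllable k) : F := (-1) ^+ s.1.2 * s.2.+1%:R.

Lemma prod_syllable s q :
  \prod_(a <- expand (s :: q)) letter_mx a =
    (1 + syl_exponent s *: step (sylidx s)) * \prod_(a <- expand q) letter_mx a.
Proof.
rewrite big_cat big_nseq; congr (_ * _); rewrite /syl_exponent.
elim: s.2.+1 => [|n IHn]; first by rewrite mulr0 scale0r addr0.
rewrite iterS IHn; rewrite /letter_mx -/(sylidx s).
by rewrite [LHS]step_comb -[n.+1%:R]nat1r mulrDr mulr1.
Qed.

(** If row 0 of [A] has reached vertex [c] of the path and nothing beyond, and the
    rest of the path spells the indices of [q], then each syllable of [q] moves
    the front by exactly one vertex and multiplies its value by the exponent. *)
Lemma path_coef A q p1 (c d : 'I_(size p).+1) :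
    p = p1 ++ map (@sylidx k) q -> c = size p1 :> nat -> d = size p :> nat ->
    (forall e : 'I_(size p).+1, (c < e)%N -> A 0 e = 0) ->
  (A * \prod_(a <- expand q) letter_mx a) 0 d = A 0 c * \prod_(s <- q) syl_exponent s.
Proof.
elim: q A p1 c => [|s q IHq] A p1 c def_p def_c def_d A0.
  rewrite !big_nil !mulr1; congr (A 0 _); apply/val_inj.
  by rewrite /= def_c def_d def_p cats0.
have pc : onth p c = Some (sylidx s).
  by rewrite def_c def_p onth_cat ltnn subnn.
have lt_c : (c.+1 < (size p).+1)%N.
  by rewrite def_c def_p size_cat /= addnS !ltnS leq_addr.
rewrite prod_syllable mulrA (IHq _ (rcons p1 (sylidx s)) (Ordinal lt_c)) //.
- rewrite big_cons mulrA; congr (_ * _).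
  rewrite mulrDr mulr1 -scalerAr mxE [A 0 (Ordinal _)]A0 // add0r mxE.
  by rewrite (@mul_step _ _ _ c) // pc eqxx mulr1 mulrC.
- by rewrite cat_rcons.
- by rewrite size_rcons -def_c.
move=> e /= lt_ce; rewrite mulrDr mulr1 -scalerAr mxE A0 ?(ltnW lt_ce) // add0r mxE.
have lt_e : (e.-1 < (size p).+1)%N by rewrite (leq_ltn_trans (leq_pred e)).
rewrite (@mul_step _ _ _ (Ordinal lt_e)) /= ?(ltn_predK lt_ce) //.
by rewrite A0 ?mul0r ?mulr0 //= -ltnS (ltn_predK lt_ce).
Qed.

(** A syllable following those of the path leaves the corner entry unchanged: its
    index differs from the label of the last edge.  A second extra syllable could
    carry that label and contribute, hence the bound on [q2]. *)
Lemma path_rep_coef w q0 q2 :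
    fgword w = expand (q0 ++ q2) -> (size q2 <= 1)%N ->
    alternating (map (@sylidx k) (q0 ++ q2)) -> p = map (@sylidx k) q0 ->
  path_rep w 0 ord_max = \prod_(s <- q0) syl_exponent s.
Proof.
move=> def_w sz_q2 alt_q def_p; rewrite /path_rep def_w expand_cat big_cat /=.
have coef0 : (\prod_(a <- expand q0) letter_mx a) 0 ord_max =
             \prod_(s <- q0) syl_exponent s.
  have := @path_coef 1 q0 [::] 0 ord_max def_p erefl erefl.
  rewrite mul1r mxE eqxx mul1r; apply=> e lt0e.
  by rewrite mxE -val_eqE ltn_eqF.
case: q2 sz_q2 alt_q {def_w} => [|s [|//]] _ alt_q; first by rewrite big_nil mulr1.
rewrite prod_syllable big_nil mulr1 mulrDr mulr1 -scalerAr mxE coef0 mxE.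
rewrite mul_step_neq ?mulr0 ?addr0 // => c pc /=; apply/eqP=> sz_p.
have: onth (p ++ [:: sylidx s]) c = Some (sylidx s).
  by rewrite onth_cat pc sz_p ltnSn.
have: alternating (p ++ [:: sylidx s]) by rewrite def_p -(map_cat _ q0 [:: s]).
move=> /alternating_onth/[apply]/negP[].
by rewrite onth_cat sz_p ltnn subnn.
Qed.

End PathRepresentation.

(** * Short words in the subgroup *)

(** The corner entry of the image of [w] is a product of exponents, nonzero
    modulo [l], whereas membership would force the identity matrix. *)
Lemma alternating_notin k l (w : freegroup k) q : prime l ->
    fgword w = expand q -> alternating (map (@sylidx k) q) ->
    (0 < size q <= l)%N -> {in q, forall s, ~~ (l %| s.2.+1)} ->
  ~ set_prod (power_subgroup (freegroup k) l) (lower_central (freegroup k) l) w.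
Proof.
move=> l_prime def_w alt_q /andP[q_gt0 le_ql] small w_in.
have l_gt1 := prime_gt1 l_prime.
(* At most [l.-1] syllables make a path whose matrices have size at most [l]. *)
set q0 := take l.-1 q; set p := map (@sylidx k) q0.
have alt_p : alternating p by rewrite /p map_take; apply: take_sorted.
have sz_p : size p = minn l.-1 (size q) by rewrite size_map size_take_min.
have pF : l \in [pchar 'F_l]%R by apply: pchar_Fp.
have rho1 : path_rep 'F_l p w = 1%R.
  apply: (unitri_rep_kills _ _ _ pF) w_in.
  - exact: path_rep1.
  - exact: path_repM.
  - exact: path_rep_unitri.
  - by rewrite sz_p; lia.
have := @path_rep_coef k 'F_l p alt_p w q0 (drop l.-1 q).
rewrite cat_take_drop size_drop rho1 mxE => /(_ def_w _ alt_q erefl) coef.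
have /eqP : (\prod_(s <- q0) syl_exponent 'F_l s = 0)%R.
  rewrite -coef; last by lia.
  by rewrite -val_eqE /= sz_p; case: eqP => //; lia.
apply/negP; rewrite prodf_seq_neq0; apply/allP=> s /mem_take s_q /=.
by rewrite mulf_neq0 ?signr_eq0 // -(dvdn_pcharf pF) small.
Qed.

Definition fgletter k (a : letter k) : freegroup k := @FreeGroup k [:: a] isT.

Lemma fgletterX k (a : letter k) n : fgword (fgletter a ^+ n)%g = nseq n a.
Proof.
elim: n => // n IHn; rewrite expgS /= IHn.
by case: n {IHn} => //= n; rewrite eq_sym linv_neq.
Qed.

Lemma fgX_expE k (i : 'I_k) n :
  (fgX i ^+ n = fgletter (i, false) ^+ n)%g /\ (fgX i ^- n = fgletter (i, true) ^+ n)%g.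
Proof.
by split; last rewrite -expVgn; congr (_ ^+ n)%g; apply/val_inj.
Qed.

Theorem theorem3 (k l : nat) (l_prime : prime l) (w : freegroup k)
    (w_in : set_prod (power_subgroup (freegroup k) l)
                     (lower_central (freegroup k) l) w)
    (w_neq1 : w <> 1%g) :
  l <= fglength w /\
  (fglength w = l <-> exists i : 'I_k, w = (fgX i ^+ l)%g \/ w = (fgX i ^- l)%g).
Proof.
have short : fglength w <= l -> exists a, w = (fgletter a ^+ l)%g.
  move=> le_wl; have [q def_w alt_q] := syllables (fgwordP w).
  have le_l : size (expand q) <= l by rewrite -def_w.
  have [[a def_q]|small] := short_expand le_l.
    by exists a; apply/val_inj; rewrite /= fgletterX def_w.
  case: (alternating_notin l_prime def_w alt_q _ _ w_in).
    rewrite (leq_trans (size_expand q)) // andbT lt0n size_eq0.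
    by apply/eqP=> q0; apply/w_neq1/val_inj; rewrite /= def_w q0.
  by move=> s /small lt_l; rewrite gtnNdvd.
have lenX (a : letter k) : fglength (fgletter a ^+ l)%g = l.
  by rewrite /fglength fgletterX size_nseq.
split.
  rewrite leqNgt; apply/negP=> lt_wl; have [a def_w] := short (ltnW lt_wl).
  by rewrite def_w lenX ltnn in lt_wl.
split=> [len_w | [i [] ->]]; last first.
- by have [_ ->] := fgX_expE i l.
- by have [-> _] := fgX_expE i l.
have [|[i b] def_w] := short; first by rewrite len_w.
exists i; have [-> ->] := fgX_expE i l.
by case: b def_w; [right | left].
Qed.
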